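(* Let $X$ be a real Hilbert space, let $f\colon X\to\left]-\infty,+\infty\right]$ be convex, lower semicontinuous, and proper, and let $x,x^*\in X$. Let $(\gamma_n)_{n\geq 1}$ be a sequence of strictly positive real numbers. Generate $(a_n)_{n\geq 1}$ and $(a_n^* )_{n\geq 0}$ in $X$ via $a_0^*:=x^*$ and, for every $n\geq 1$, $$a_n := \operatorname{Prox}_{\gamma_n f}(x+\gamma_n a_{n-1}^* )\quad\text{and}\quad a_n^* := \frac{x+\gamma_n a_{n-1}^*-a_n}{\gamma_n}.$$ Then $$f(x)+f^*(x^* )-\langle x,x^*\rangle \;\geq\; \sum_{k=1}^\infty \frac{\|x-\operatorname{Prox}_{\gamma_k f}(x+\gamma_k a_{k-1}^* )\|^2}{\gamma_k}.$$
   Context: $f^*(x^* )=\sup_{x\in X}(\langle x,x^*\rangle-f(x))$ is the Fenchel conjugate of $f$. For $\gamma>0$, $\operatorname{Prox}_{\gamma f}=(\mathrm{Id}+\gamma\partial f)^{-1}$ is the proximal mapping of $\gamma f$, i.e., $\operatorname{Prox}_{\gamma f}(z)$ is the unique minimizer over $u\in X$ of $\gamma f(u)+\tfrac12\|u-z\|^2$. Both sides of the inequality are understood as elements of $[0,+\infty]$. *)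

(* Defs.v *)
From HB Require Import structures.
From mathcomp Require Import all_boot all_order all_algebra.
From mathcomp Require Import sesquilinear.
From mathcomp Require Import all_classical all_reals all_analysis.
From mathcomp Require Import ring lra.

Set Implicit Arguments.
Unset Strict Implicit.
Unset Printing Implicit Defensive.

Import Order.TTheory GRing.Theory Num.Theory.
Import numFieldNormedType.Exports.

Local Open Scope classical_set_scope.
Local Open Scope ring_scope.
Local Open Scope ereal_scope.

(* A real Hilbert space is a [completeNormedModType R] together with an inner
   product [ip : {dot X for idfun}] whose associated norm is that of [X]. *)
Definition induces_norm (R : realType) (X : normedModType R)
    (ip : {dot X for (@idfun R)}) : Prop :=
  forall u : X, (`|u| ^+ 2 = ip u u)%R.

Section ConvexAnalysis.
Context {R : realType} {X : normedModType R}.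
Implicit Types (f : X -> \bar R) (ip : {dot X for (@idfun R)}).

(* A function with values in ]-oo, +oo] that is not identically +oo. *)
Definition proper_fun f : Prop :=
  (forall u, -oo < f u) /\ exists u, f u < +oo.

Definition econvex f : Prop :=
  forall (t : R) (u v : X), (0 < t < 1)%R ->
    f (t *: u + (1 - t) *: v)%R <= t%:E * f u + (1 - t)%:E * f v.

Definition fenchel_conj ip f (us : X) : \bar R :=
  ereal_sup [set (ip u us)%:E - f u | u in [set: X]].

Definition subdifferential ip f (p : X) : set X :=
  [set v | forall u, f p + (ip (u - p)%R v)%:E <= f u].

(* (Id + g * subdifferential f)^-1 as a set-valued map *)
Definition resolvent ip (g : R) f (z : X) : set X :=
  [set p | exists2 v, subdifferential ip f p v & z = (p + g *: v)%R].

Lemma resolvent_minimizerP ip (g : R) f (z p : X) :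
  induces_norm ip -> econvex f -> proper_fun f -> (0 < g)%R ->
  resolvent ip g f z p <->
  (forall u, g%:E * f p + (`|p - z| ^+ 2 / 2)%:E <=
             g%:E * f u + (`|u - z| ^+ 2 / 2)%:E).
Proof.
move=> ipN cf [fNy [w fw]] g0.
have nD (y v : X) : (`|y + v| ^+ 2 = `|y| ^+ 2 + 2 * ip y v + `|v| ^+ 2)%R.
  rewrite !ipN linearD /= !linearDl /= (hermC ip v y) /= expr0 mul1r.
  by ring.
have exp_at (u : X) :
    (`|u - z| ^+ 2 = `|u - p| ^+ 2 + 2 * ip (u - p) (p - z) + `|p - z| ^+ 2)%R.
  by rewrite -nD subrKA.
split.
- case=> v sv zE u.
  have fpfin : f p \is a fin_num.
    rewrite fin_numE gt_eqF ?fNy //=; apply/eqP => fpy.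
    by move: (sv w); rewrite fpy addye // leye_eq => /eqP e; rewrite e in fw.
  have := sv u.
  move: (fNy u); case: (f u) => [fu| |] // _; last first.
    by move=> _; rewrite gt0_muley ?lte_fin // addye // leey.
  rewrite -(fineK fpfin) -EFinD lee_fin -!EFinM -!EFinD lee_fin => sub.
  have -> : (`|u - z| ^+ 2 = `|u - p| ^+ 2 - 2 * g * ip (u - p) v
             + `|p - z| ^+ 2)%R.
    rewrite exp_at; congr (_ + _ + _)%R.
    by rewrite zE opprD addrA subrr sub0r linearN /= linearZ /=; ring.
  have : (g * (fine (f p) + ip (u - p) v) <= g * fu)%R by rewrite ler_pM2l.
  have : (0 <= `|u - p| ^+ 2)%R by rewrite exprn_ge0.
  by lra.
- move=> minp.
  have fpfin : f p \is a fin_num.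
    rewrite fin_numE gt_eqF ?fNy //=; apply/eqP => fpy.
    move: (minp w); rewrite fpy gt0_muley ?lte_fin // addye //.
    move: fw (fNy w); by case: (f w).
  exists (g^-1 *: (z - p))%R; last first.
    by rewrite scalerA divff ?gt_eqF // scale1r addrC subrK.
  move=> u; rewrite linearZ /=.
  have := fun t => cf t u p.
  move: (fNy u); case Efu: (f u) => [fu| |] // _ cu; last exact: leey.
  rewrite -(fineK fpfin) in cu minp *.
  rewrite -EFinD lee_fin.
  rewrite -subr_ge0 -(pmulr_rge0 _ g0).
  set c := ip (u - p)%R (z - p)%R.
  have -> : (g * (fu - (fine (f p) + g^-1 * c)) = g * (fu - fine (f p)) - c)%R.
    by field; rewrite gt_eqF.
  set A := (X in (0 <= X)%R).
  have step t : (0 < t < 1)%R -> (0 <= A + t * (`|u - p| ^+ 2 / 2))%R.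
    move=> t01; have /andP[t0 t1] := t01.
    have := minp (t *: u + (1 - t) *: p)%R.
    have := cu t t01; have := fNy (t *: u + (1 - t) *: p)%R.
    case: (f (t *: u + (1 - t) *: p)%R) => [ft| |] // _.
    rewrite -!EFinM -!EFinD !lee_fin => h1.
    have ipZ y v : (ip (t *: y) v = t * ip y v)%R by exact: linearZl_LR.
    rewrite (exp_at (t *: u + (1 - t) *: p)%R).
    have -> : (t *: u + (1 - t) *: p - p = t *: (u - p))%R.
      by rewrite scalerBl scale1r scalerBr addrA addrAC addrK.
    rewrite normrZ exprMn ipZ -(opprB z p) linearN /= -/c normrN.
    rewrite (ger0_norm (ltW t0)) => h2.
    rewrite -(pmulr_rge0 _ t0) /A.
    have : (g * ft <= g * (t * fu + (1 - t) * fine (f p)))%R by rewrite ler_pM2l.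
    by move: h2; rewrite !expr2; lra.
  rewrite leNgt; apply/negP => A0.
  set N := (`|u - p| ^+ 2 / 2)%R in step.
  have N0 : (0 <= N)%R by rewrite divr_ge0 ?exprn_ge0.
  have d0 : (0 < N + 1 - A)%R by lra.
  have ht : (0 < - A / (N + 1 - A) < 1)%R.
    by rewrite divr_gt0 ?oppr_gt0 //= ltr_pdivrMr // mul1r; lra.
  have := step _ ht.
  rewrite -(pmulr_rge0 _ d0).
  have -> : ((N + 1 - A) * (A + - A / (N + 1 - A) * N) = A * (1 - A))%R.
    by field; rewrite gt_eqF.
  by rewrite nmulr_rge0 //; lra.
Qed.

(* The resolvent is single-valued with full domain when X is complete, f is
   convex, lower semicontinuous and proper, and 0 < g; the default value 0 is
   only used outside of that setting. *)
Definition prox ip (g : R) f (z : X) : X := xget 0%R (resolvent ip g f z).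

End ConvexAnalysis.

(* Main.v *)
(* Write [f'] for the conjugate of [f] and [s_n] for [as_ n]. The Fenchel gap
   [D(s) = f x + f' s - <x, s>] is nonnegative. Since [s_n] is a subgradient of
   [f] at [a_n], the Fenchel-Young inequality is an equality at [(a_n, s_n)];
   this gives [D(s_(n-1)) - D(s_n) >= <x - a_n, s_n - s_(n-1)>], which equals
   [|x - a_n|^2 / gamma_n], and the sum telescopes. The resolvent is nonempty
   because near-minimizers of the strongly convex function
   [g f + |. - z|^2 / 2] form a Cauchy filter, whose limit is a minimizer by
   lower semicontinuity. *)
Require Import Defs.
From HB Require Import structures.
From mathcomp Require Import all_boot all_order all_algebra.
From mathcomp Require Import sesquilinear.
From mathcomp Require Import all_classical all_reals all_analysis.
From mathcomp Require Import ring lra.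

Set Implicit Arguments.
Unset Strict Implicit.
Unset Printing Implicit Defensive.

Import Order.TTheory GRing.Theory Num.Theory.
Import numFieldNormedType.Exports.

Local Open Scope classical_set_scope.
Local Open Scope ring_scope.

Section RealInnerProduct.
Context {R : realType} {X : normedModType R}.
Variables (ip : {dot X for (@idfun R)}).

Lemma dotC (u v : X) : ip u v = ip v u.
Proof. by rewrite (hermC ip u v) /= expr0 mul1r. Qed.

Lemma parallelogram (u v : X) : induces_norm ip ->
  `|u + v| ^+ 2 + `|u - v| ^+ 2 = 2 * (`|u| ^+ 2 + `|v| ^+ 2).
Proof.
move=> ipN; rewrite !ipN !linearD /= !linearN /= !linearDl /= !linearNl /=.
by rewrite (dotC v u); ring.
Qed.

End RealInnerProduct.

Section FenchelYoung.
Context {R : realType} {X : normedModType R}.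
Variables (ip : {dot X for (@idfun R)}) (f : X -> \bar R).

Lemma fenchel_young (p us : X) :
  ((ip p us)%:E - f p <= fenchel_conj ip f us)%E.
Proof. by apply: ereal_sup_ubound; exists p. Qed.

Lemma fenchel_conj_gtNy (us : X) : proper_fun f ->
  (-oo < fenchel_conj ip f us)%E.
Proof.
move=> [fNy [w fw]]; apply: lt_le_trans (fenchel_young w us).
by move: fw (fNy w); case: (f w) => // r _ _; rewrite -EFinB ltNyr.
Qed.

(** Fenchel-Young at [x]; properness keeps [f x] and the conjugate above [-oo], so in every infinite
    case the sum is [+oo]. *)
Lemma fenchel_gap_ge0 (x us : X) : proper_fun f ->
  (0 <= f x + (fenchel_conj ip f us - (ip x us)%:E))%E.
Proof.
move=> fP; have := fenchel_conj_gtNy us fP; have := fenchel_young x us.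
have := fP.1 x; case: (f x) => [fx| |] //=;
  case: (fenchel_conj ip f us) => [c| |] //= _ + _.
  by rewrite -!EFinB -EFinD !lee_fin; lra.
all: by move=> _; rewrite ?(addye, addey) // leey.
Qed.

Lemma subdifferential_fin_num (p v : X) : proper_fun f ->
  subdifferential ip f p v -> f p \is a fin_num.
Proof.
move=> [fNy [w fw]] /(_ w); move: fw (fNy p).
by case: (f p) => // fw _; rewrite addye // leye_eq => /eqP e; rewrite e in fw.
Qed.

(** The subgradient inequality rearranges to [ip u v - f u <= ip p v - f p]: the supremum is
    attained at [p]. *)
Lemma fenchel_conj_subdifferential (p v : X) : proper_fun f ->
  subdifferential ip f p v -> fenchel_conj ip f v = ((ip p v)%:E - f p)%E.
Proof.
move=> fP sv; apply/eqP; rewrite eq_le fenchel_young andbT.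
apply: ge_ereal_sup => _ [u _ <-].
have := sv u; rewrite -(fineK (subdifferential_fin_num fP sv)).
rewrite linearBl /=; case: (f u) (fP.1 u) => [fu| |] //= _.
- by rewrite -EFinD -!EFinB !lee_fin; lra.
- by rewrite leNye.
Qed.

(* With [x - p = g (v - us)], the Fenchel gap decreases from [us] to [v] by at
   least [ip (x - p) (v - us) = |x - p|^2 / g]. *)
Lemma fenchel_gap_decrease (g : R) (x us p v : X) :
  induces_norm ip -> proper_fun f -> 0 < g ->
  subdifferential ip f p v -> x + g *: us = p + g *: v ->
  ((`|x - p| ^+ 2 / g)%:E + (fenchel_conj ip f v - (ip x v)%:E) <=
   fenchel_conj ip f us - (ip x us)%:E)%E.
Proof.
move=> ipN fP g0 sv E.
have xp : x - p = g *: (v - us).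
  by rewrite scalerBr -(addrK (g *: us) x) E addrAC [p + _]addrC addrK.
have -> : `|x - p| ^+ 2 / g = ip x v - ip x us - ip p v + ip p us.
  rewrite ipN {2}xp linearZ /= mulrC mulKf ?gt_eqF //.
  by rewrite linearBl /= !linearB /=; ring.
(* The conjugate is known exactly at [v] and bounded below at [us] by Fenchel-Young at the same
   point [p], so [f p] cancels. *)
rewrite (fenchel_conj_subdifferential fP sv).
have := fenchel_young p us; have := fenchel_conj_gtNy us fP.
rewrite -(fineK (subdifferential_fin_num fP sv)).
case: (fenchel_conj ip f us) => [c| |] //= _; last by move=> _; rewrite addye // leey.
by rewrite -!EFinB -EFinD !lee_fin; lra.
Qed.

End FenchelYoung.

Section Resolvent.
Context {R : realType}.

(* A lower bound near a point of the domain propagates along segments, at a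
   rate linear in the distance; this replaces the usual affine minorant and
   avoids the Hahn-Banach theorem. *)
Lemma econvex_lsc_norm_minorant (X : normedModType R) (f : X -> \bar R) :
  econvex f -> lower_semicontinuous f -> proper_fun f ->
  exists A K : R, forall u, ((A - K * `|u|)%:E <= f u)%E.
Proof.
move=> cf lf [fNy [w fwy]].
have [fw fwE] : exists fw, f w = fw%:E.
  by move: fwy (fNy w); case: (f w) => // r _ _; exists r.
have [] := lf w (fw - 1); first by rewrite fwE lte_fin; lra.
move=> V /nbhs_normP [d /= d0 dV] Vf.
(* These constants come from [fu - fw > - t^-1 = - (d + D + 1) / d], with [t] and [D] as below,
   after the triangle inequality on [D]. *)
exists (fw - (d + `|w| + 1) / d), d^-1 => u.
move: (fNy u); case fuE: (f u) => [fu| |] // _; last by rewrite leey.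
set D : R := `|u - w|.
have D0 : 0 <= D by exact: normr_ge0.
(* [t * D < d] keeps the convex combination in the ball where [f] exceeds [fw - 1], while [t^-1] is
   affine in [D]. *)
pose t : R := d / (d + D + 1).
have s0 : 0 < d + D + 1 by lra.
have t0 : 0 < t by rewrite divr_gt0.
have t01 : 0 < t < 1 by rewrite t0 /= /t ltr_pdivrMr // mul1r; lra.
have : (f (t *: u + (1 - t) *: w)%R <= t%:E * f u + (1 - t)%R%:E * f w)%E.
  exact: cf.
have : ((fw - 1)%R%:E < f (t *: u + (1 - t) *: w)%R)%E.
  apply: Vf; apply: dV => /=.
  have -> : w - (t *: u + (1 - t) *: w) = - (t *: (u - w)).
    by rewrite scalerBl scale1r scalerBr addrCA opprD addrA subrr add0r.
  rewrite normrN normrZ gtr0_norm // -/D /t mulrAC ltr_pdivrMr //.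
  by rewrite ltr_pM2l //; lra.
move=> /lt_le_trans /[apply]; rewrite fuE fwE -!EFinM -EFinD lte_fin lee_fin => h.
have : - t^-1 < fu - fw.
  rewrite -(ltr_pM2l t0) mulrN mulfV ?gt_eqF //.
  by lra.
have -> : t^-1 = (d + D + 1) / d by rewrite /t invf_div.
have : D <= `|u| + `|w| by exact: ler_normB.
have d'0 : 0 <= d^-1 by rewrite invr_ge0 ltW.
by move=> /(ler_wpM2r d'0); rewrite !mulrDl (mulrC d^-1); lra.
Qed.

Lemma resolvent_nonempty (X : completeNormedModType R)
    (ip : {dot X for (@idfun R)}) (f : X -> \bar R) (g : R) (z : X) :
  induces_norm ip -> econvex f -> lower_semicontinuous f -> proper_fun f ->
  0 < g -> resolvent ip g f z !=set0.
Proof.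
move=> ipN cf lf fP g0.
have [A [K minf]] := econvex_lsc_norm_minorant cf lf fP.
(* Quantifying over real [r >= f u] keeps the objective real-valued. *)
pose h (u : X) (r : R) := g * r + `|u - z| ^+ 2 / 2.
pose S := [set s | exists u r, (f u <= r%:E)%E /\ s = h u r].
have hS u r : (f u <= r%:E)%E -> S (h u r) by move=> fur; exists u, r.
have S0 : S !=set0.
  have [fNy [w fw]] := fP; move: (fNy w) fw.
  case E: (f w) => [r| |] // _ _; exists (h w r); apply: hS.
  by rewrite E.
have Slb : has_lbound S.
  (* The last term comes from completing the square in the distance from [u] to [z]. The sign of [K]
     is unknown, hence its absolute value. *)
  exists (g * A - g * `|K| * `|z| - (g * `|K|) ^+ 2 / 2) => _ [u [r [fur ->]]].
  have : A - K * `|u| <= r by rewrite -lee_fin; exact: le_trans fur.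
  rewrite -(ler_pM2l g0) /h.
  have : `|u| <= `|u - z| + `|z| by rewrite -{1}(subrK z u) ler_normD.
  have gK0 : 0 <= g * `|K| by rewrite mulr_ge0 // ltW.
  move/(ler_wpM2l gK0).
  have : g * (K * `|u|) <= g * `|K| * `|u|.
    by rewrite -mulrA ler_pM2l // ler_wpM2r // ler_norm.
  have : 0 <= (`|u - z| - g * `|K|) ^+ 2 by rewrite sqr_ge0.
  by rewrite !expr2; lra.
pose m := inf S.
have mh u r : (f u <= r%:E)%E -> m <= h u r by move=> fur; apply: ge_inf => //; exact: hS.
pose B (e : R) := [set u | exists2 r, (f u <= r%:E)%E & h u r < m + e].
have B0 e : 0 < e -> B e !=set0.
  move=> e0; have [_ [u [r [fur ->]]] lt] := inf_adherent e0 (conj S0 Slb).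
  by exists u; exists r.
pose F := filter_from [set e : R | 0 < e] B.
have FF : ProperFilter F.
  apply: filter_from_proper; last by move=> e /B0.
  apply: filter_from_filter; first by exists 1 => /=.
  move=> i j i0 j0; exists (Num.min i j); first by rewrite /= lt_min i0.
  move=> u [r fur lt]; split; exists r => //; apply: lt_le_trans lt _.
    by rewrite lerD2l ge_min lexx.
  by rewrite lerD2l ge_min lexx orbT.
(* By convexity and the parallelogram law, the objective at the midpoint is at most the mean of the
   two values minus an eighth of the squared distance; it is also at least [m]. *)
have diam e u v : B e u -> B e v -> `|u - v| ^+ 2 < 8 * e.
  move=> [r fur hur] [s fvs hvs].
  have half : 0 < (2^-1 : R) < 1 by lra.
  have fm : (f (2^-1 *: u + (1 - 2^-1) *: v)%R <= (2^-1 * r + (1 - 2^-1) * s)%:E)%E.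
    rewrite EFinD 2!EFinM; apply: le_trans (cf _ _ _ half) _.
    by apply: leeD; apply: lee_wpmul2l => //; rewrite lee_fin; lra.
  have := mh _ _ fm; move: hur hvs; rewrite /h.
  have -> : 2^-1 *: u + (1 - 2^-1) *: v - z = 2^-1 *: ((u - z) + (v - z)).
    have -> : 1 - 2^-1 = 2^-1 :> R by lra.
    rewrite addrACA -opprD !scalerDr scalerN scalerDr -scalerDl.
    by have -> : 2^-1 + 2^-1 = 1 :> R; [lra|rewrite scale1r].
  have := parallelogram (u - z) (v - z) ipN.
  have -> : u - z - (v - z) = u - v by rewrite opprB addrA subrK.
  rewrite normrZ exprMn gtr0_norm ?invr_gt0 // (expr2 2^-1).
  by lra.
have /cvg_ex [p Fp] : cvg F.
  apply/cauchy_cvgP; apply: cauchy_exP => e e0.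
  pose d := e ^+ 2 / 8.
  have d0 : 0 < d by rewrite divr_gt0 ?exprn_gt0.
  have [u Bu] := B0 _ d0.
  exists u; exists d => // v Bv.
  rewrite -ball_normE /= -(ltr_pXn2r (n := 2)) ?nnegrE ?normr_ge0 ?(ltW e0) //.
  by apply: lt_le_trans (diam _ _ _ Bu Bv) _; rewrite /d; lra.
have cvh : `|u - z| ^+ 2 / 2 @[u --> F] --> `|p - z| ^+ 2 / 2.
  apply: cvgMl; rewrite expr2; under eq_fun do rewrite expr2.
  have cn : `|u - z| @[u --> F] --> `|p - z|.
    by apply: cvg_norm; apply: cvgB => //; exact: cvg_cst.
  exact: cvgM.
(* Real levels [b] stand in for [f p], which could still be [+oo]. Near [p], [f] exceeds [b], and
   the quadratic term passes to the limit along [F]. *)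
have key b : (b%:E < f p)%E -> g * b + `|p - z| ^+ 2 / 2 <= m.
  move=> bfp; have [V Vp Vb] := lf _ _ bfp.
  apply/ler_addgt0Pr => e e0.
  rewrite -lerBrDl; apply: cvgr_to_le cvh _.
  have FB : F (B e) by exists e.
  near=> u.
  have [r fur] : B e u by near: u.
  have Vu : V u by near: u; exact: Fp.
  have : b <= r by rewrite -lee_fin; apply: le_trans fur; exact: ltW (Vb _ Vu).
  by rewrite -(ler_pM2l g0) /h; lra.
exists p; apply/resolvent_minimizerP => // u.
have fpE : exists2 fp, f p = fp%:E & g * fp + `|p - z| ^+ 2 / 2 <= m.
  move: (fP.1 p) key; case: (f p) => [fp| |] // _ key.
    exists fp => //; apply/ler_addgt0Pr => e e0.
    have := key (fp - e / g).
    rewrite lte_fin ltrBlDr ltrDl divr_gt0 // => /(_ isT).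
    by rewrite mulrBr mulrCA mulfV ?gt_eqF //; lra.
  (* If [f p] were [+oo], this level would turn [key] into [m + 1 <= m]. *)
  have := key ((m + 1 - `|p - z| ^+ 2 / 2) / g) (ltry _).
  by rewrite mulrCA mulfV ?gt_eqF //; lra.
have [fp -> fpm] := fpE.
move: (fP.1 u); case fuE: (f u) => [fu| |] // _.
  rewrite -!EFinM -!EFinD lee_fin; apply: le_trans fpm _.
  by apply: mh; rewrite fuE.
by rewrite gt0_muley ?lte_fin // addye // leey.
Unshelve. all: by end_near. Qed.

(** Nonemptiness makes [xget] return a true resolvent point instead of its default [0]; the
    subgradient is then solved from [z = p + g *: v]. *)
Lemma prox_subdifferential (X : completeNormedModType R)
    (ip : {dot X for (@idfun R)}) (f : X -> \bar R) (g : R) (z : X) :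
  induces_norm ip -> econvex f -> lower_semicontinuous f -> proper_fun f ->
  0 < g ->
  subdifferential ip f (prox ip g f z) (g^-1 *: (z - prox ip g f z)).
Proof.
move=> ipN cf lf fP g0.
have [v] : resolvent ip g f z (prox ip g f z).
  by apply: xgetPex; exact: resolvent_nonempty.
move: (prox ip g f z) => p sv ->.
by rewrite (addrC p) addrK scalerA mulVf ?gt_eqF // scale1r.
Qed.

End Resolvent.

Theorem corollary7p4 (R : realType) (X : completeNormedModType R)
  (ip : {dot X for (@idfun R)}) (ip_norm : induces_norm ip)
  (f : X -> \bar R) (f_convex : econvex f) (f_lsc : lower_semicontinuous f)
  (f_proper : proper_fun f) (x xs : X)
  (gamma : nat -> R) (gamma_gt0 : forall n, (1 <= n)%N -> 0 < gamma n)
  (a as_ : nat -> X) (as0 : as_ 0%N = xs)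
  (aE : forall n, (1 <= n)%N ->
    a n = prox ip (gamma n) f (x + gamma n *: as_ n.-1))
  (asE : forall n, (1 <= n)%N ->
    as_ n = (gamma n)^-1 *: (x + gamma n *: as_ n.-1 - a n)) :
  (f x + fenchel_conj ip f xs - (ip x xs)%:E >=
   \sum_(1 <= k <oo)
     (`|x - prox ip (gamma k) f (x + gamma k *: as_ k.-1)| ^+ 2 / gamma k)%:E)%E.
Proof.
pose c k := (`|x - prox ip (gamma k) f (x + gamma k *: as_ k.-1)| ^+ 2
             / gamma k)%:E.
pose gap n := (fenchel_conj ip f (as_ n) - (ip x (as_ n))%:E)%E.
have c_ge0 k : (1 <= k)%N -> true -> (0 <= c k)%E.
  by move=> k1 _; rewrite lee_fin divr_ge0 ?exprn_ge0 // ltW // gamma_gt0.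
(* Additive form, as [gap n] may be [+oo] and differences would be ill-behaved. *)
have gap_step n : (c n.+1 + gap n.+1 <= gap n)%E.
  have g0 := gamma_gt0 n.+1 isT.
  rewrite /c -aE //; apply: fenchel_gap_decrease => //.
    rewrite (asE n.+1) // (aE n.+1) //; exact: prox_subdifferential.
  by rewrite (asE n.+1) // scalerA mulfV ?gt_eqF // scale1r [RHS]addrC subrK.
have partial n : (\sum_(1 <= k < n.+1) c k + gap n <= gap 0%N)%E.
  elim: n => [|n IHn]; first by rewrite big_geq // add0e.
  rewrite big_nat_recr //= -addeA; apply: le_trans IHn.
  exact: leeD2l.
rewrite -as0 -addeA; apply: lime_le; first exact: is_cvg_nneseries.
near=> n; have n1 : (1 <= n)%N by near: n; exact: nbhs_infty_ge.
(* The partial sum stops before [n], whereas [partial] bounds sums stopping before a successor. *)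
rewrite -(prednK n1).
apply: (@le_trans _ _ (f x + (\sum_(1 <= k < n.-1.+1) c k + gap n.-1)))%E.
  by rewrite addeCA leeDl // fenchel_gap_ge0.
exact: leeD2l.
Unshelve. all: by end_near. Qed.
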